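(* Suppose that there exist $\mathfrak c$ pairwise Rudin–Keisler incomparable selective ultrafilters on $\omega$. Then there exists a Hausdorff topological group $G$ such that $G^n$ is countably pracompact for every positive integer $n$, but $G^{\omega}$ is not countably pracompact.
   Context: A space $X$ is countably pracompact if there is a dense set $D\subseteq X$ such that every infinite subset of $D$ has an accumulation point in $X$. Selective ultrafilter: a free ultrafilter $p$ on $\omega$ such that for every partition $\{A_n\}$ of $\omega$ either some $A_n\in p$ or some $B\in p$ meets each $A_n$ in exactly one point. Rudin–Keisler: $p\le_{RK}q$ iff $p=\{A:f^{-1}(A)\in q\}$ for some $f:\omega\to\omega$; incomparable means neither $p\le_{RK}q$ nor $q\le_{RK}p$. Powers carry the product topology. *)

(* Defs.v *)
From HB Require Import structures.
From mathcomp Require Import all_boot all_order all_algebra.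
From mathcomp Require Import all_classical all_reals all_analysis.
Set Implicit Arguments. Unset Strict Implicit. Unset Printing Implicit Defensive.
Local Open Scope classical_set_scope.

Definition ultrafilter_on_nat (p : set (set nat)) : Prop :=
  [/\ ~ p set0, p setT,
      (forall A B : set nat, p A -> A `<=` B -> p B),
      (forall A B : set nat, p A -> p B -> p (A `&` B)) &
      (forall A : set nat, p A \/ p (~` A))].

Definition free_ultrafilter (p : set (set nat)) : Prop :=
  ultrafilter_on_nat p /\ (forall A : set nat, finite_set A -> ~ p A).

Definition partition_of_nat (A : nat -> set nat) : Prop :=
  [/\ (forall n, A n !=set0),
      (forall n m, n <> m -> A n `&` A m = set0) &
      (forall k, exists n, A n k)].

Definition selective_ultrafilter (p : set (set nat)) : Prop :=
  free_ultrafilter p /\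
  forall A : nat -> set nat, partition_of_nat A ->
    (exists n, p (A n)) \/
    (exists B : set nat, p B /\ forall n, exists! k, B k /\ A n k).

Definition RK_le (p q : set (set nat)) : Prop :=
  exists f : nat -> nat, p = [set A : set nat | q (f @^-1` A)].

Definition RK_incomparable (p q : set (set nat)) : Prop :=
  ~ RK_le p q /\ ~ RK_le q p.

Definition accumulation_point (X : topologicalType) (A : set X) (x : X) : Prop :=
  limit_point A x.

Definition countably_pracompact (X : topologicalType) : Prop :=
  exists D : set X, dense D /\
    forall A : set X, A `<=` D -> infinite_set A ->
      exists x : X, accumulation_point A x.

Definition topological_group (G : topologicalType)
    (mul : G -> G -> G) (inv : G -> G) (e : G) : Prop :=
  [/\ associative mul, left_id e mul, left_inverse e inv mul,
      continuous (fun xy : G * G => mul xy.1 xy.2) & continuous inv].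

Definition finpower (G : topologicalType) (n : nat) : topologicalType :=
  prod_topology (fun _ : 'I_n => G).
Definition omegapower (G : topologicalType) : topologicalType :=
  prod_topology (fun _ : nat => G).

(* Main.v *)
(** Index the ultrafilters U_a by the pairs (n, h), with h = (h_0, ..., h_{n-1}) a tuple of sequences
    in a set X of size c, so that every tuple receives an ultrafilter of its own.  Take a family of
    maps chi_j : X -> Z/2 that is independent, yet realizes every prescription of values on a
    countable subset of X.  Then X maps densely into (Z/2)^J, and G is the subgroup generated by the
    limits along U_a of the sequences h_i, i < n.  The powers of X are dense in those of G, and the
    limits put into G make G^n countably pracompact.

    Let D be dense in G^omega.  Choose countable sets C_0 <= C_1 <= ... in X and x_k in D such that the
    coordinates x_k(0), ..., x_k(k) only involve C_{k+1} and are independent over the functions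
    vanishing on C_k.  Suppose that x_k converges to e along an ultrafilter q.  By selectivity and
    incomparability at most one a has limits which the block map X -> omega (k on C_{k+1} \ C_k) pushes
    to q, and those n limits see at most n points in each block.  Since n + 1 coordinates are
    independent on the block, some function kills these points but not all of x_k(0), ..., x_k(n).
    Glueing such functions along a set of q gives a character equal to 1 on some coordinate of the
    x_k, and to 0 on the same coordinate of e. *)

Require Import Defs.
From HB Require Import structures.
From mathcomp Require Import all_boot all_order all_algebra.
From mathcomp Require Import all_classical all_reals all_analysis.
Set Implicit Arguments. Unset Strict Implicit. Unset Printing Implicit Defensive.
Local Open Scope classical_set_scope.

(** * Ultrafilters on [nat] and selectivity *)

Lemma ultra_setC (p : set (set nat)) (A : set nat) :
  ultrafilter_on_nat p -> p (~` A) <-> ~ p A.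
Proof.
case=> p0 _ pS pI pU; split=> [pC pA|npA]; last by case: (pU A).
by apply: p0; rewrite -(setICr A); exact: pI.
Qed.

Lemma ultra_seq (p : set (set nat)) (f : nat -> nat) (s : seq nat) :
  ultrafilter_on_nat p -> p (f @^-1` [set` s]) ->
  exists v, p (f @^-1` [set v]).
Proof.
move=> up; have [p0 _ pS pI pU] := up; elim: s => [|v s IHs] ps.
  by exfalso; apply: p0; apply: pS ps _ => k /=; rewrite in_nil.
have [pv|/(ultra_setC _ up) pv] := EM (p (f @^-1` [set v])); first by exists v.
apply: IHs; apply: pS (pI _ _ ps pv) _ => k [/= + nfk].
by rewrite in_cons => /orP[/eqP|].
Qed.

(** The fibres of [f] form a partition with no member in [p], so selectivity picks one point in
    each. *)
Lemma selective_injective_on (p : set (set nat)) (f : nat -> nat) :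
  selective_ultrafilter p -> (forall v, ~ p (f @^-1` [set v])) ->
  exists2 B, p B & forall k l, B k -> B l -> f k = f l -> k = l.
Proof.
move=> [[up _] psel] nconst; have [p0 pT pS pI pU] := up.
(* [partition_of_nat] wants nonempty pieces indexed by all of [nat], so the range of [f] must be
   infinite. *)
have finf : infinite_set (range f).
  move=> /finite_seqP[s fs]; have [v pv] : exists v, p (f @^-1` [set v]).
    by apply: (@ultra_seq p f s) => //; rewrite -fs; apply: pS pT _ => k _; exists k.
  exact: nconst pv.
have /card_set_bijP[e [emem einj esurj]] : ([set: nat] #= range f)%card.
  by rewrite card_eq_sym; apply: eq_card_nat; [exact: countableP|exact: finf].
have efun n : exists k, f k = e n.
  by have [k _ fk] := emem n I; exists k.
case: (psel (fun n => f @^-1` [set e n])) => [|[n pn]|[B [pB Bn]]].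
- split=> [n|n m nm|k].
  + by have [k fk] := efun n; exists k.
  + apply/seteqP; split=> // k [/= -> enm]; apply: nm.
    by apply: einj; rewrite ?inE.
  + by have [n _ en] : (e @` setT) (f k); [apply: esurj; exists k|exists n].
- by case: (nconst _ pn).
- exists B => // k l Bk Bl fkl.
  have [n _ en] : (e @` setT) (f k) by apply: esurj; exists k.
  have [m [_ mu]] := Bn n.
  rewrite -(mu k (conj Bk (esym en))); apply: mu; split=> //=.
  by rewrite -fkl en.
Qed.

(* A selective ultrafilter is RK-minimal: a non-constant image of it is RK-equivalent to it. *)
Lemma RK_le_common_image (p r q : set (set nat)) (f g : nat -> nat) :
  selective_ultrafilter p -> (forall v, ~ q [set v]) ->
  (forall A, p (f @^-1` A) <-> q A) -> (forall A, r (g @^-1` A) <-> q A) ->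
  RK_le p r.
Proof.
move=> psel qfree fq gq.
have [v /fq/qfree//|B pB Binj] := @selective_injective_on p f psel.
have [[[p0 _ pS pI _] _] _] := psel.
have [s sP] : {s : nat -> nat & forall v, (exists2 k, B k & f k = v) -> B (s v) /\ f (s v) = v}.
  apply: (@choice _ _ (fun v k => (exists2 k, B k & f k = v) -> B k /\ f k = v)) => v.
  have [[k Bk fk]|nk] := EM (exists2 k, B k & f k = v); first by exists k.
  by exists 0%N => /nk.
have sf k : B k -> s (f k) = k.
  by move=> Bk; have [|? ?] := sP (f k); [exists k|exact: Binj].
(* [s] inverts [f] on [B], so [s \o g] carries [r] to [p]. *)
exists (s \o g); apply/seteqP; split=> A /=.
  move=> pA; rewrite comp_preimage; apply/gq/fq.
  by apply: pS (pI _ _ pA pB) _ => k [Ak Bk] /=; rewrite sf.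
rewrite comp_preimage => /gq/fq pA; apply: pS (pI _ _ pA pB) _ => k [/= + Bk].
by rewrite sf.
Qed.

(** * Sets of size at most the continuum *)

Definition cantor := nat -> bool.

Definition coded (T : Type) := exists d : cantor -> T, forall t, exists a, d a = t.

Lemma coded_cantor : coded cantor.
Proof. by exists id => a; exists a. Qed.

Lemma coded_countable (T : countType) (t0 : T) : coded T.
Proof.
exists (fun a : cantor => if pselect (exists n, a n) is left ex
                 then odflt t0 (choice.unpickle (ex_minn ex)) else t0) => t.
exists (pred1 (choice.pickle t)); case: pselect => [ex|[]]; last first.
  by exists (choice.pickle t) => /=.
by case: ex_minnP => n /eqP -> _; rewrite choice.pickleK.
Qed.

Lemma coded_pair (T T' : Type) : coded T -> coded T' -> coded (T * T').
Proof.
move=> [d dP] [d' dP'].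
exists (fun a : cantor => (d (fun m => a m.*2), d' (fun m => a m.*2.+1))) => -[t t'].
have [a <-] := dP t; have [a' <-] := dP' t'.
exists (fun m => if odd m then a' m./2 else a m./2).
by congr (d _, d' _); apply/funext => m /=; rewrite odd_double ?doubleK //= uphalf_double.
Qed.

Lemma coded_sequence (T : Type) : coded T -> coded (nat -> T).
Proof.
move=> [d dP].
exists (fun (a : cantor) n => d (fun m => a (choice.pickle (n, m)))) => t.
have [b bP] := choice (fun n => dP (t n)).
exists (fun k => if choice.unpickle k is Some nm then b nm.1 nm.2 else false).
by apply/funext => n; rewrite -(bP n); congr d; apply/funext => m; rewrite choice.pickleK.
Qed.

(** The set X. The first component can escape any countable set; the second, then free, carries the
    independent family. *)
Definition base := (cantor * seq (seq bool))%type.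

Lemma coded_base : coded base.
Proof. exact: coded_pair coded_cantor (coded_countable [::]). Qed.

Lemma countable_range_cover (T : Type) (t0 : T) (C : set T) :
  countable C -> exists c : nat -> T, C `<=` range c.
Proof.
move=> /pfcard_geP[->|[c]]; first by exists (fun=> t0).
by exists c => t /(@surj _ _ _ _ c)[n _ <-]; exists n.
Qed.

Lemma notin_countable_cantor (C : set cantor) :
  countable C -> exists a, ~ C a.
Proof.
move=> /(countable_range_cover (fun=> false))[c Cc].
exists (fun n => ~~ c n n) => /Cc[n _ /(congr1 (@^~ n))].
by case: (c n n).
Qed.

Lemma separating_prefix (s : seq cantor) :
  exists n, {in s &, forall a b, mkseq a n = mkseq b n -> a = b}.
Proof.
have [m mP] : {m : cantor -> cantor -> nat &
    forall a b, a (m a b) = b (m a b) -> a = b}.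
  apply: (@choice _ _ (fun a (f : cantor -> nat) => forall b, a (f b) = b (f b) -> a = b)) => a.
  suff [f fP] : {f : cantor -> nat & forall b, a (f b) = b (f b) -> a = b} by exists f.
  apply: (@choice _ _ (fun b n => a n = b n -> a = b)) => b.
  have [->|nab] := EM (a = b); first by exists 0%N.
  apply: contrapT => nex; apply: nab; apply/funext => n.
  by apply: contrapT => nabn; apply: nex; exists n.
exists (\max_(a <- s) \max_(b <- s) (m a b).+1) => a b sa sb eqab; apply: mP.
set n := \max_(_ <- _) _ in eqab.
have mn : (m a b < n)%N.
  apply: leq_trans (leq_bigmax_seq a sa isT).
  exact: (@leq_bigmax_seq _ _ xpredT (fun b => (m a b).+1) _ sb isT).
by have := congr1 (nth false ^~ (m a b)) eqab; rewrite /= !nth_mkseq.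
Qed.

(** * Independent characters extending countable prescriptions *)

Section characters.

Variable code : cantor -> (nat -> base) * cantor * nat.

(* A character agrees with the function coded by its index on the countable set coded by its index.
   Elsewhere it is a member of the usual independent family of subsets of the countable set
   [seq (seq bool)].  The ignored last component of the code makes every such prescription recur for
   infinitely many indices. *)
Definition chi (j : cantor) (x : base) : bool :=
  let: (c, w, _) := code j in
  if `[< range c x >] then `[< exists2 m, c m = x & w m >]
  else has (fun l => l == mkseq j (size l)) x.2.

Lemma chi_extend (C : set base) (psi : base -> bool) :
  (forall t, exists j, code j = t) -> countable C ->
  exists iota : nat -> cantor, injective iota /\
    forall m x, C x -> chi (iota m) x = psi x.
Proof.
move=> codeP /(countable_range_cover (fun=> false, [::]))[c Cc].
have [iota iotaP] := choice (fun m => codeP (c, psi \o c, m)).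
exists iota; split=> [m m' eqm|m x /Cc cx].
  by have := iotaP m; rewrite eqm iotaP => -[].
rewrite /chi iotaP asboolT //; case: cx => m' _ cm'.
apply/asboolP/idP => [[k <-]//|psix]; exists m' => //=.
by rewrite cm'.
Qed.

(** The first component of [x] avoids the countable sets coded by [s]; the second lists prefixes,
    long enough to separate [s], of the indices in [s] where [b] holds. *)
Lemma chi_independent (s : seq cantor) (b : cantor -> bool) :
  exists x, {in s, forall j, chi j x = b j}.
Proof.
have [n nP] := separating_prefix s.
have [a aP] : exists a, ~ (\bigcup_(j in [set` s]) range (fun m => ((code j).1.1 m).1)) a.
  apply: notin_countable_cantor; apply: bigcup_countable.
    by apply: finite_set_countable; exact: finite_seq.
  by move=> j _; apply: sub_countable (card_image_le _ _) (countableP _).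
exists (a, [seq mkseq j n | j <- s & b j]) => j sj.
rewrite /chi; case Ej : (code j) => [[c w] m]; rewrite asboolF => [|[k _ ck]]; last first.
  by apply: aP; exists j => //; exists k => //; rewrite Ej /= ck.
apply/hasP/idP => [[_ /mapP[j' + ->]]|bj].
  rewrite mem_filter size_mkseq => /andP[bj' sj'] /eqP eqj.
  by rewrite -(nP j' j).
by exists (mkseq j n); [apply: map_f; rewrite mem_filter bj|rewrite size_mkseq].
Qed.

End characters.

(** * Subspaces and subgroups of a power of Z/2 *)

Definition subcube (J : eqType) (S : set (J -> bool)) := {g : J -> bool | S g}.

Section subcube_topology.
Variables (J : eqType) (S : set (J -> bool)).
Implicit Types g h : subcube S.

Definition subcube_nbhs g : set (set (subcube S)) :=
  [set U | exists s : seq J, forall h, {in s, sval h =1 sval g} -> U h].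

HB.instance Definition _ := gen_eqMixin (subcube S).
HB.instance Definition _ := gen_choiceMixin (subcube S).
HB.instance Definition _ := hasNbhs.Build (subcube S) subcube_nbhs.

Lemma subcube_nbhs_filter g : ProperFilter (subcube_nbhs g).
Proof.
apply: Build_ProperFilter_ex; first by move=> U [s sU]; exists g; exact: sU.
split=> [|U V [s sU] [t tV]|U V UV [s sU]]; first by exists [::].
  exists (s ++ t) => h hst; split; [apply: sU|apply: tV] => j js;
    by apply: hst; rewrite mem_cat js ?orbT.
by exists s => h /sU/UV.
Qed.

Lemma subcube_nbhs_singleton g (U : set (subcube S)) : subcube_nbhs g U -> U g.
Proof. by move=> [s]; apply. Qed.

Lemma subcube_nbhs_nbhs g (U : set (subcube S)) :
  subcube_nbhs g U -> subcube_nbhs g (subcube_nbhs^~ U).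
Proof.
move=> [s sU]; exists s => h hg; exists s => h' h'h; apply: sU => j js.
by rewrite h'h ?hg.
Qed.

HB.instance Definition _ := Nbhs_isNbhsTopological.Build (subcube S)
  subcube_nbhs_filter subcube_nbhs_singleton subcube_nbhs_nbhs.

Lemma subcube_inj g h : sval g =1 sval h -> g = h.
Proof. by case: g h => [g Sg] [h Sh] /= /funext gh; exact: eq_exist. Qed.

Lemma nbhs_subcube g j : nbhs g [set h | sval h j = sval g j].
Proof. by exists [:: j] => h; apply; rewrite mem_seq1. Qed.

Lemma hausdorff_subcube : hausdorff_space (subcube S).
Proof.
move=> g h gh; apply: subcube_inj => j.
by have [k [/= <-]] := gh _ _ (nbhs_subcube g j) (nbhs_subcube h j).
Qed.

Lemma nbhs_power (I : eqType) (x : prod_topology (fun _ : I => subcube S)) i j :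
  nbhs x [set y | sval (y i) j = sval (x i) j].
Proof. exact: (@proj_continuous _ (fun=> subcube S) i x _ (nbhs_subcube (x i) j)). Qed.

Lemma open_power (I : eqType) (i : I) (j : J) (b : bool) :
  open [set y : prod_topology (fun _ : I => subcube S) | sval (y i) j = b].
Proof. by rewrite openE => x /= <-; exact: nbhs_power. Qed.

Lemma open_cylinder (I : eqType) (w : prod_topology (fun _ : I => subcube S))
    (s : seq (I * J)) :
  open [set y : prod_topology (fun _ : I => subcube S) |
    {in s, forall ij, sval (y ij.1) ij.2 = sval (w ij.1) ij.2}].
Proof.
elim: s => [|[i j] s IHs].
  by rewrite (_ : [set _ | _] = setT); [exact: openT|apply/seteqP; split].
rewrite (_ : [set _ | _] = [set y | sval (y i) j = sval (w i) j] `&` [set y |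
    {in s, forall ij, sval (y ij.1) ij.2 = sval (w ij.1) ij.2}]).
  by apply: openI => //; exact: open_power.
apply/seteqP; split=> y /= => [ys|[yi ys] ij].
  split=> [|ij ijs]; first by apply: (ys (i, j)); rewrite mem_head.
  by apply: ys; rewrite in_cons ijs orbT.
by rewrite in_cons => /predU1P[->|/ys].
Qed.

Lemma nbhs_power_basis (I : eqType) (x : prod_topology (fun _ : I => subcube S)) U :
  nbhs x U -> exists s : seq (I * J),
    forall y : prod_topology (fun _ : I => subcube S),
      {in s, forall ij, sval (y ij.1) ij.2 = sval (x ij.1) ij.2} -> U y.
Proof.
pose F : set_system (prod_topology (fun _ : I => subcube S)) := [set V | exists s : seq (I * J),
  forall y : prod_topology (fun _ : I => subcube S),
    {in s, forall ij, sval (y ij.1) ij.2 = sval (x ij.1) ij.2} -> V y].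
have FF : Filter F.
  split=> [|V W [s sV] [t tW]|V W VW [s sV]]; first by exists [::].
    exists (s ++ t) => y yst; split; [apply: sV|apply: tW] => ij ijs;
      by apply: yst; rewrite mem_cat ijs ?orbT.
  by exists s => y /sV/VW.
suff : F --> x by apply.
apply/cvg_sup => i V [W [[A oA <-] Ax AV]].
have [s sA] : nbhs (x i) A by exact: open_nbhs_nbhs.
exists [seq (i, j) | j <- s] => y yx; apply: AV; apply: sA => j js.
by apply: (yx (i, j)); exact: map_f.
Qed.

End subcube_topology.

Section subcube_group.
Variables (J : eqType) (S : set (J -> bool)).
Hypotheses (S0 : S (fun=> false))
  (SD : forall g h, S g -> S h -> S (fun j => g j (+) h j)).

Definition subcube_add (g h : subcube S) : subcube S :=
  exist _ _ (SD (proj2_sig g) (proj2_sig h)).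

Definition subcube_zero : subcube S := exist _ _ S0.

Lemma subcube_topological_group : topological_group subcube_add id subcube_zero.
Proof.
split.
- by move=> x y z; apply: subcube_inj => j; exact: addbA.
- by move=> x; apply: subcube_inj => j; exact: addFb.
- by move=> x; apply: subcube_inj => j; exact: addbb.
- move=> [x y] U [s sU].
  exists ([set x' : subcube S | {in s, sval x' =1 sval x}], [set y' : subcube S | {in s, sval y' =1 sval y}]).
    by split; exists s.
  by move=> [x' y'] [/= x'x y'y]; apply: sU => j js /=; rewrite x'x ?y'y.
- by move=> x U.
Qed.

End subcube_group.

Lemma infinite_set_sequence (T : Type) (A : set T) :
  infinite_set A -> exists2 f : nat -> T, injective f & forall k, A (f k).
Proof.
elim/Ppointed: T => T in A *; first by rewrite emptyE => /(_ (finite_set0 _)).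
move=> /infiniteP/pcard_leP[f]; exists f => [k l|k]; first by apply: inj; rewrite inE.
exact: funS.
Qed.

(** * Finite sums of ultrafilter limits *)

Section ultrafilter_sums.
Variables (U : set nat -> set (set nat)) (dec : set nat -> nat * (nat -> nat -> base)).
Hypothesis U_ultra : forall a, ultrafilter_on_nat (U a).

(* A pair (a, i) stands for the (U a)-limit of the i-th sequence coded by a. *)
Definition lim_code := (set nat * nat)%type.
Implicit Types (y : lim_code) (s : seq lim_code) (phi psi : base -> bool).

Definition lim_seq y (k : nat) : base := (dec y.1).2 y.2 k.
Definition lim_valid y := (y.2 < (dec y.1).1)%N.
(** The limit, in discrete Z/2, of [phi] along the sequence. *)
Definition lim_eval y phi : bool := `[< U y.1 [set k | phi (lim_seq y k)] >].
Definition sum_eval s phi : bool := \big[addb/false]_(y <- s) lim_eval y phi.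
Definition carrier s : set base := \bigcup_(y in [set` s]) range (lim_seq y).

Lemma lim_eval_eq y phi psi :
  (forall k, phi (lim_seq y k) = psi (lim_seq y k)) -> lim_eval y phi = lim_eval y psi.
Proof.
move=> e; congr `[< U _ _ >]; apply/seteqP; split=> k /=; by rewrite e.
Qed.

Lemma lim_eval0 y : lim_eval y (fun=> false) = false.
Proof.
apply: asboolF => p0; have [np0 _ pS _ _] := U_ultra y.1.
by apply: np0; apply: pS p0 _.
Qed.

Lemma lim_evalD y phi psi :
  lim_eval y (fun x => phi x (+) psi x) = lim_eval y phi (+) lim_eval y psi.
Proof.
have up := U_ultra y.1; have [p0 pT pS pI pU] := up.
rewrite /lim_eval; set P := [set k | phi _]; set Q := [set k | psi _].
have [pP|npP] := asboolP (U y.1 P); have [pQ|npQ] := asboolP (U y.1 Q) => /=.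
- apply: asboolF => pPQ; apply: p0; apply: pS (pI _ _ (pI _ _ pP pQ) pPQ) _.
  by move=> k [[/= -> ->]].
- apply/asboolP; move/(ultra_setC _ up): npQ => pQ.
  by apply: pS (pI _ _ pP pQ) _ => k [/= -> /negP/negbTE ->].
- apply/asboolP; move/(ultra_setC _ up): npP => pP.
  by apply: pS (pI _ _ pP pQ) _ => k [/= /negP/negbTE -> ->].
- apply: asboolF => pPQ.
  move/(ultra_setC _ up): npQ => pQ; move/(ultra_setC _ up): npP => pP.
  apply: p0; apply: pS (pI _ _ (pI _ _ pP pQ) pPQ) _.
  by move=> k [[/= /negP/negbTE -> /negP/negbTE ->]].
Qed.

Lemma sum_eval_eq s phi psi :
  (forall x, carrier s x -> phi x = psi x) -> sum_eval s phi = sum_eval s psi.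
Proof.
move=> e; apply: eq_big_seq => y ys; apply: lim_eval_eq => k.
by apply: e; exists y => //; exists k.
Qed.

Lemma sum_eval0 s : sum_eval s (fun=> false) = false.
Proof. by apply: big1 => y _; exact: lim_eval0. Qed.

Lemma sum_evalD s phi psi :
  sum_eval s (fun x => phi x (+) psi x) = sum_eval s phi (+) sum_eval s psi.
Proof. by rewrite -big_split /=; apply: eq_bigr => y _; exact: lim_evalD. Qed.

Lemma sum_eval_sum s (I : Type) (r : seq I) (P : pred I) (F : I -> base -> bool) :
  sum_eval s (fun x => \big[addb/false]_(i <- r | P i) F i x) =
  \big[addb/false]_(i <- r | P i) sum_eval s (F i).
Proof.
elim: r => [|i r IHr].
  rewrite big_nil -[RHS](sum_eval0 s); apply: sum_eval_eq => x _.
  by rewrite big_nil.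
rewrite big_cons -IHr; case Pi: (P i); rewrite -?sum_evalD;
  by apply: sum_eval_eq => x _; rewrite big_cons Pi.
Qed.

Lemma countable_carrier s : countable (carrier s).
Proof.
apply: bigcup_countable; first by apply: finite_set_countable; exact: finite_seq.
by move=> y _; apply: sub_countable (card_image_le _ _) (countableP _).
Qed.

Variable code : cantor -> (nat -> base) * cantor * nat.

(** The group G. Validity leaves finitely many limits per ultrafilter, on which the later pigeonhole
    argument depends. *)
Definition lim_span : set (cantor -> bool) :=
  [set g | exists2 s, all lim_valid s & g = fun j => sum_eval s (chi code j)].

Lemma lim_span0 : lim_span (fun=> false).
Proof. by exists [::] => //; apply/funext => j; rewrite /sum_eval big_nil. Qed.

Lemma lim_spanD g h : lim_span g -> lim_span h -> lim_span (fun j => g j (+) h j).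
Proof.
move=> [s sv ->] [t tv ->]; exists (s ++ t); first by rewrite all_cat sv.
by apply/funext => j; rewrite /sum_eval big_cat.
Qed.

Lemma lim_span_lim y : lim_valid y -> lim_span (fun j => lim_eval y (chi code j)).
Proof.
move=> yv; exists [:: y]; first by rewrite /= yv.
by apply/funext => j; rewrite /sum_eval big_seq1.
Qed.

Hypothesis dec_surj : forall t, exists a, dec a = t.

(** A point is the limit of its constant sequence. *)
Lemma lim_span_point x : lim_span (fun j => chi code j x).
Proof.
have [a decE] := dec_surj (1%N, fun _ _ => x).
have -> : (fun j => chi code j x) = (fun j => lim_eval (a, 0%N) (chi code j)).
  apply/funext => j; rewrite /lim_eval /lim_seq decE /=.
  have [p0 pT _ _ _] := U_ultra a; apply/idP/asboolP => [cx|].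
    by rewrite (_ : [set _ | _] = setT) //; apply/seteqP; split.
  by apply: contraPT => /negP ncx; rewrite (_ : [set _ | _] = set0) //; apply/seteqP; split.
by apply: lim_span_lim; rewrite /lim_valid decE.
Qed.

(** * Density of the points, and the finite powers *)

Local Notation G := (subcube lim_span).

Lemma dense_points (I : eqType) :
  dense [set y : prod_topology (fun _ : I => G) |
    forall i, exists x, sval (y i) = fun j => chi code j x].
Proof.
move=> O [y Oy] oO.
have [s sO] := nbhs_power_basis (open_nbhs_nbhs (conj oO Oy)).
have [x xP] := choice (fun i =>
  chi_independent code [seq ij.2 | ij <- s] (sval (y i))).
exists (fun i => exist _ _ (lim_span_point (x i))); split=> [|i]; last by exists (x i).
by apply: sO => ij ijs /=; apply: xP; exact: map_f.
Qed.

Hypothesis U_free : forall a A, finite_set A -> ~ U a A.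

Lemma countably_pracompact_finpower (n : nat) :
  (0 < n)%N -> countably_pracompact (finpower G n).
Proof.
case: n => // n _; eexists; split=> [|A AD]; first exact: (@dense_points 'I_n.+1).
move=> /infinite_set_sequence[f finj fA].
have /choice[t tP] : forall k, exists tk : 'I_n.+1 -> base,
    forall i, sval (f k i) = fun j => chi code j (tk i).
  by move=> k; have [tk tkP] := choice (AD _ (fA k)); exists tk.
(* One index codes all the coordinate sequences, so one ultrafilter gives the joint limit [e]. *)
have [a decE] := dec_surj (n.+1, fun i k => t k (inord i)).
have [p0 pT pS pI _] := U_ultra a.
have av i : (i < n.+1)%N -> lim_valid (a, i) by rewrite /lim_valid decE.
pose e : finpower G n.+1 :=
  fun i => exist _ _ (lim_span_lim (av _ (ltn_ord i))).
exists e => V /nbhs_power_basis[s sV].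
have Us : U a [set k | {in s, forall ij, sval (f k ij.1) ij.2 = sval (e ij.1) ij.2}].
  elim: {sV} s => [|[i j] s IHs]; first by apply: pS pT _.
  have Ui : U a [set k | sval (f k i) j = sval (e i) j].
    rewrite /e /=; have [q|nq] := boolP (lim_eval (a, nat_of_ord i) (chi code j)).
      move/asboolP in q; apply: (pS _ _ q) => k /=.
      by rewrite /lim_seq decE /= inord_val tP.
    have /asboolPn/(ultra_setC _ (U_ultra a)) q := nq.
    apply: (pS _ _ q) => k /= /negP/negbTE.
    by rewrite /lim_seq decE /= inord_val tP.
  apply: pS (pI _ _ Ui IHs) _ => k [/= ki ks] ij.
  by rewrite in_cons => /predU1P[->|/ks].
(* By injectivity [f] takes the value [e] at most once, and [U a] is free. *)
have Une : U a [set k | f k != e].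
  have q : U a (~` [set k | f k = e]).
    apply/ultra_setC => //; apply: U_free; apply: sub_finite_set (finite_set1 (xget 0%N [set k | f k = e])).
    move=> k /= fk; apply: finj; rewrite fk.
    by rewrite (@xgetPex _ 0%N [set k | f k = e]) //; exists k.
  by apply: (pS _ _ q) => k /= /eqP.
have [k [ks ke]] : [set k | {in s, forall ij, sval (f k ij.1) ij.2 = sval (e ij.1) ij.2}]
    `&` [set k | f k != e] !=set0.
  by apply/set0P/eqP => E0; apply: p0; rewrite -E0; exact: pI.
by exists (f k); split=> //; exact: sV.
Qed.

(** * Blocks, and the obstruction to a common limit *)

Section blocks.
Variables (v : nat -> nat -> seq lim_code) (C : nat -> set base)
  (phi : nat -> nat -> base -> bool).
Hypotheses (C_mono : forall k, C k `<=` C k.+1)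
  (v_carrier : forall k i, carrier (v k i) `<=` C k.+1)
  (phi_out : forall k m x, C k x -> phi k m x = false)
  (phi_dual : forall k i m, (i <= k)%N -> (m <= k)%N ->
    sum_eval (v k i) (phi k m) = (i == m)).

(** Points outside every [C k.+1] also fall into block 0, so [rho] below tests membership in
    [C k.+1] separately. *)
Definition block (x : base) : nat :=
  if pselect (exists k, `[< C k.+1 x >]) is left ex then ex_minn ex else 0%N.

Lemma C_le k l : (k <= l)%N -> C k `<=` C l.
Proof.
elim: l => [|l IHl]; first by rewrite leqn0 => /eqP ->.
by rewrite leq_eqVlt => /predU1P[->//|/IHl kl] x /kl/C_mono.
Qed.

Lemma block_le k x : C k.+1 x -> (block x <= k)%N.
Proof.
move=> Cx; rewrite /block; case: pselect => [ex|//].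
by case: ex_minnP => m _; apply; exact/asboolP.
Qed.

Lemma block_eq k x : C k.+1 x -> ~ C k x -> block x = k.
Proof.
move=> Cx nCx; apply/eqP; rewrite eqn_leq block_le //= leqNgt.
apply/negP; rewrite /block; case: pselect => [ex|[]]; last first.
  by exists k; apply/asboolP.
by case: ex_minnP => m /asboolP Cm _ mk; apply: nCx; exact: C_le mk _ Cm.
Qed.

Variable q : set (set nat).
Hypotheses (q_ultra : ultrafilter_on_nat q)
  (q_free : forall A, finite_set A -> ~ q A).

Definition pushes_to y := forall A, U y.1 ((block \o lim_seq y) @^-1` A) <-> q A.

Hypothesis U_selective : forall a, selective_ultrafilter (U a).
Hypothesis U_incomparable : forall a b, a <> b -> RK_incomparable (U a) (U b).

Lemma pushes_to_unique : exists a, forall y, pushes_to y -> y.1 = a.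
Proof.
have [[y0 qy0]|nq] := EM (exists y, pushes_to y); last first.
  by exists set0 => y qy; case: nq; exists y.
exists y0.1 => y qy; apply: contrapT => /U_incomparable[+ _]; apply.
apply: (RK_le_common_image (U_selective _) _ qy qy0) => k.
exact/q_free/finite_set1.
Qed.

(* A limit whose image under [block] is the free ultrafilter [q] lives on a set meeting every block
   in at most one point. *)
Lemma pushes_to_thin y : pushes_to y -> exists z : nat -> base,
  exists2 B, U y.1 B & forall k, B k -> lim_seq y k = z (block (lim_seq y k)).
Proof.
move=> qy.
have [k /qy /(q_free (finite_set1 _)) //|B UB Binj] :=
  @selective_injective_on _ (block \o lim_seq y) (U_selective y.1).
have [z zP] : {z : nat -> base & forall n k, B k -> block (lim_seq y k) = n -> lim_seq y k = z n}.
  apply: (@choice _ _ (fun n x => forall k, B k -> block (lim_seq y k) = n -> lim_seq y k = x)) => n.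
  have [[l Bl ln]|nl] := EM (exists2 l, B l & block (lim_seq y l) = n).
    by exists (lim_seq y l) => k Bk kn; rewrite (Binj k l) //= kn ln.
  by exists (lim_seq y 0) => k Bk kn; case: nl; exists k.
by exists z; exists B => // k Bk; exact: zP.
Qed.

(* More functions [phi k m] than points: some sum of them vanishes at all the points. *)
Lemma dual_vanishing n k (z : nat -> base) : (n <= k)%N ->
  exists (psi : base -> bool) (i : nat),
    [/\ (i <= n)%N, forall x, C k x -> psi x = false,
        forall l, (l < n)%N -> psi (z l) = false & sum_eval (v k i) psi].
Proof.
move=> nk.
pose F (P : {ffun 'I_n.+1 -> bool}) x := \big[addb/false]_(m <- index_enum _ | P m) phi k m x.
pose pat (P : {ffun 'I_n.+1 -> bool}) := [ffun l : 'I_n => F P (z l)].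
have /injectivePn[P [Q PQ patPQ]] : ~~ injectiveb pat.
  apply/injectiveP => /leq_card; rewrite !card_ffun card_bool !card_ord.
  by rewrite leq_exp2l // ltnn.
have leI (i : 'I_n.+1) : (i <= k)%N by exact: leq_trans (leq_ord i) nk.
(* By duality [F R] evaluates to [R i] at [v k i], so the sum of [F P] and [F Q] gives 1 at any [i]
   where [P] and [Q] differ. *)
have FE (i : 'I_n.+1) (R : {ffun 'I_n.+1 -> bool}) : sum_eval (v k i) (F R) = (R i).
  rewrite sum_eval_sum; have [iR|niR] := boolP (R i).
    rewrite (bigD1 i) //= phi_dual ?eqxx //.
    rewrite big1 // => m /andP[_ mi]; rewrite phi_dual //.
    by rewrite eq_sym; exact: negbTE.
  rewrite big1 // => m mR; rewrite phi_dual //.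
  by apply/negbTE; apply: contra niR => /eqP/val_inj ->.
have [i iPQ] : exists i, (P i) != (Q i).
  apply/existsP; apply: contraNT PQ => /existsPn eqPQ; apply/eqP/ffunP => i.
  by apply/eqP; rewrite -[_ == _]negbK eqPQ.
exists (fun x => F P x (+) F Q x), i; split=> [|x Cx|l ln|].
- by rewrite -ltnS.
- by rewrite /F !big1 // => m _; exact: phi_out.
- by have /ffunP/(_ (Ordinal ln)) := patPQ; rewrite !ffunE /= => ->; exact: addbb.
- by rewrite sum_evalD !FE; case: (P i) (Q i) iPQ => [] [].
Qed.

(** A function [f], glued from functions living on single blocks, separates some coordinate [i]: it
    is 1 at [v k i] for all [k] in a set of [q], yet 0 at [e i]. *)
Lemma no_common_limit (e : nat -> seq lim_code) :
  (forall i, all lim_valid (e i)) ->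
  ~ (forall i psi, q [set k | sum_eval (v k i) psi = sum_eval (e i) psi]).
Proof.
move=> ev lim; have [q0 qT qS qI qU] := q_ultra.
(* Only limits along [U a] can push to [q], and the valid ones are [(a, l)] with [l < n]. Below,
   [z l k] is the one point of block [k] that such a limit sees. *)
have [a aP] := pushes_to_unique; pose n := (dec a).1.
have [z zP] : {z : nat -> nat -> base & forall l, pushes_to (a, l) ->
    exists2 B, U a B & forall k, B k -> lim_seq (a, l) k = z l (block (lim_seq (a, l) k))}.
  apply: (@choice _ _ (fun l zl => pushes_to (a, l) ->
    exists2 B, U a B & forall k, B k -> lim_seq (a, l) k = zl (block (lim_seq (a, l) k)))) => l.
  have [/pushes_to_thin[zl zlP]|nl] := EM (pushes_to (a, l)); first by exists zl.
  by exists (fun=> (fun=> false, [::])) => /nl.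
have [psi psiP] : {psi : nat -> (base -> bool) * nat & forall k, (n <= k)%N ->
    [/\ ((psi k).2 <= n)%N, forall x, C k x -> (psi k).1 x = false,
        forall l, (l < n)%N -> (psi k).1 (z l k) = false & sum_eval (v k (psi k).2) (psi k).1]}.
  apply: (@choice _ _ (fun k (p : (base -> bool) * nat) => (n <= k)%N ->
    [/\ (p.2 <= n)%N, forall x, C k x -> p.1 x = false,
        forall l, (l < n)%N -> p.1 (z l k) = false & sum_eval (v k p.2) p.1])) => k.
  have [nk|nk] := leqP n k; last by exists (fun=> false, 0%N).
  by have [p [i pi]] := dual_vanishing (fun l => z l k) nk; exists (p, i).
(* The coordinate chosen with [psi] is at most [n], hence constant on a set of [q]. *)
have [i qi] : exists i, q ((fun k => (psi k).2) @^-1` [set i]) /\ q [set k | n <= k]%N.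
  have qn : q [set k | n <= k]%N.
    rewrite (_ : [set k | _] = ~` [set k | k < n]%N).
      by apply/ultra_setC => //; apply: q_free; exact: finite_II.
    by apply/seteqP; split=> k /=; [rewrite leqNgt => /negP|move/negP; rewrite -leqNgt].
  have qs : q ((fun k => (psi k).2) @^-1` [set` iota 0 n.+1]).
    by apply: qS qn _ => k /psiP[kn _ _ _]; rewrite /preimage /mkset mem_iota.
  by have [i qi] := ultra_seq q_ultra qs; exists i.
(* A limit not pushing to [q] disagrees with it on some [A]; whichever of [A] and its complement is
   in [q] is missed by that limit. The finitely many entries of [e i] allow an intersection. *)
have [K0 qK0 K0P] : exists2 K, q K & {in e i, forall y,
    pushes_to y \/ ~ U y.1 ((block \o lim_seq y) @^-1` K)}.
  elim: (e i) => [|y s [K qK KP]]; first by exists setT.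
  have [M qM MP] : exists2 M, q M & pushes_to y \/ ~ U y.1 ((block \o lim_seq y) @^-1` M).
    have [qy|/existsNP[A nA]] := EM (pushes_to y); first by exists setT => //; left.
    have [qA|/(ultra_setC _ q_ultra) qA] := EM (q A).
      by exists A => //; right => UA; apply: nA.
    exists (~` A) => //; right; rewrite preimage_setC => /(ultra_setC _ (U_ultra _)) UA; apply: nA.
    split=> [/UA//|qA']; last by have /(ultra_setC _ q_ultra) := qA.
  exists (K `&` M); first exact: qI.
  move=> y'; rewrite in_cons => /predU1P[->|/KP].
    case: MP => [qy|nU]; [by left|right] => UK; apply: nU.
    by have [_ _ US _ _] := U_ultra y.1; apply: US UK _ => k [].
  case=> [qy|nU]; [by left|right] => UK; apply: nU.
  by have [_ _ US _ _] := U_ultra y'.1; apply: US UK _ => k [].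
pose K := K0 `&` [set k | (psi k).2 = i /\ (n <= k)%N].
have qK : q K.
  by apply: (qI) => //; case: qi => qi qn; apply: qS (qI _ _ qi qn) _ => k [].
have KP : {in e i, forall y, pushes_to y \/ ~ U y.1 ((block \o lim_seq y) @^-1` K)}.
  move=> y /K0P[qy|nU]; [by left|right] => UK; apply: nU.
  by have [_ _ US _ _] := U_ultra y.1; apply: US UK _ => k [].
(* [Phi k] is built on the blocks below [k]. For [k] in [K], stage [k] adds the function of [psi k]
   on block [k] only if [Phi k] is not already 1 at [v k i]; [f] collects all stages. *)
pose rho (Phi : base -> bool) k x :=
  [&& `[< K k >], ~~ sum_eval (v k i) Phi, (psi k).1 x & `[< C k.+1 x >]].
pose Phi := fix Phi k := if k is l.+1 then fun x => Phi l x (+) rho (Phi l) l x else fun=> false.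
pose f x := rho (Phi (block x)) (block x) x.
have rho_block k x : rho (Phi k) k x -> block x = k.
  move=> /and4P[/asboolP[_ [_ nk]] _ px /asboolP Cx]; apply: block_eq => // nCx.
  by have [_ /(_ _ nCx) + _ _] := psiP _ nk; rewrite px.
have PhiE k x : Phi k x = (block x < k)%N && f x.
  elim: k => [|k IHk] //=; rewrite IHk ltnS.
  have [bk|nbk] := eqVneq (block x) k; first by rewrite /f bk ltnn leqnn.
  have -> : rho (Phi k) k x = false.
    by apply/negP => /rho_block bk; rewrite bk eqxx in nbk.
  by rewrite addbF (leq_eqVlt (block x)) (negbTE nbk).
(* The carrier of [v k i] lies in [C k.+1], where [f] agrees with [Phi k.+1], so later stages cannot
   spoil the value. *)
have vf k : K k -> sum_eval (v k i) f.
  move=> Kk; have [_ [ik nk]] := Kk.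
  have -> : sum_eval (v k i) f = sum_eval (v k i) (fun x =>
      Phi k x (+) (~~ sum_eval (v k i) (Phi k) && (psi k).1 x)).
    apply: sum_eval_eq => x /v_carrier Cx.
    have := PhiE k.+1 x; rewrite ltnS block_le //= => <-.
    by rewrite /rho asboolT //= asboolT // andbT.
  rewrite sum_evalD; case: (boolP (sum_eval _ (Phi k))) => _ /=.
    by rewrite sum_eval0.
  by have [_ _ _] := psiP _ nk; rewrite ik.
(* [f] is supported on blocks in [K], which the limits not pushing to [q] miss; the others live on
   the points [z l k], where [psi k] vanishes. *)
have ef : sum_eval (e i) f = false.
  rewrite /sum_eval big_seq big1 // => y ye.
  apply: asboolF => Uf; have [U0 _ US UI _] := U_ultra y.1.
  have yv : lim_valid y by exact: (allP (ev i)).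
  have [qy|nU] := KP y ye; last first.
    by apply: nU; apply: US Uf _ => k /and4P[/asboolP].
  case: y qy Uf U0 US UI yv {ye} => a' l qy; have /= -> := aP _ qy.
  move: (qy); have /= -> := aP _ qy => /zP[B UB Bz] Uf U0 US UI ln.
  apply: U0; apply: US (UI _ _ Uf UB) _ => k [/and4P[/asboolP[_ [_ nk]] _ + _] /Bz zk].
  by rewrite {2}zk; have [_ _ -> //] := psiP _ nk.
have [k [Kk]] : K `&` [set k | sum_eval (v k i) f = sum_eval (e i) f] !=set0.
  by apply/set0P/eqP => E0; apply: q0; rewrite -E0; exact: qI.
by rewrite /= vf // ef.
Qed.

End blocks.

(** * Independent sequences in a dense subset of the infinite power *)

Hypothesis code_surj : forall t, exists j, code j = t.

Lemma lim_span_repr : exists rep : G -> seq lim_code,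
  forall g, all lim_valid (rep g) /\ forall j, sval g j = sum_eval (rep g) (chi code j).
Proof.
have [rep repP] : {rep : G -> seq lim_code &
    forall g, all lim_valid (rep g) /\ forall j, sval g j = sum_eval (rep g) (chi code j)}.
  apply: (@choice _ _ (fun g r => all lim_valid r /\
    forall j, sval g j = sum_eval r (chi code j))) => -[g [r rv gE]].
  by exists r; split=> //= j; rewrite gE.
by exists rep.
Qed.

(** Characters vanishing on [C] are dual to suitable points [w i]; density gives an element of [D]
    with the same finitely many values. *)
Lemma dual_step (rep : G -> seq lim_code) (D : set (omegapower G)) (C : set base) (k : nat) :
  (forall g j, sval g j = sum_eval (rep g) (chi code j)) ->
  dense D -> countable C ->
  exists (x : omegapower G) (phi : nat -> base -> bool),
    [/\ D x, forall m t, C t -> phi m t = false &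
        forall i m, (i <= k)%N -> (m <= k)%N -> sum_eval (rep (x i)) (phi m) = (i == m)].
Proof.
move=> repE Dd Cc.
have [ix [ix_inj ixC]] := chi_extend (fun=> false) code_surj Cc.
have [w wP] := choice (fun i => chi_independent code [seq ix m | m <- iota 0 k.+1]
  (fun j => `[< j = ix i >])).
have wE i m : (m <= k)%N -> chi code (ix m) (w i) = (i == m).
  move=> mk; rewrite wP; last by apply: map_f; rewrite mem_iota.
  by apply/asboolP/eqP => [/ix_inj ->|->].
pose y : omegapower G := fun i => exist _ _ (lim_span_point (w i)).
pose s := [seq (i, ix m) | i <- iota 0 k.+1, m <- iota 0 k.+1].
have [|x [xs Dx]] := Dd _ _ (open_cylinder y s); first by exists y.
exists x, (fun m => chi code (ix m)); split=> // i m ik mk.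
rewrite -repE -wE //; apply: (xs (i, ix m)).
by apply: allpairs_f; rewrite mem_iota.
Qed.

Lemma dual_sequence (rep : G -> seq lim_code) (D : set (omegapower G)) :
  (forall g j, sval g j = sum_eval (rep g) (chi code j)) -> dense D ->
  exists (x : nat -> omegapower G) (C : nat -> set base) (phi : nat -> nat -> base -> bool),
    [/\ forall k, D (x k),
        forall k, C k `<=` C k.+1,
        forall k i, carrier (rep (x k i)) `<=` C k.+1,
        forall k m t, C k t -> phi k m t = false &
        forall k i m, (i <= k)%N -> (m <= k)%N ->
          sum_eval (rep (x k i)) (phi k m) = (i == m)].
Proof.
move=> repE Dd.
pose ok (kC : nat * set base) (xp : omegapower G * (nat -> base -> bool)) :=
  [/\ D xp.1, forall m t, kC.2 t -> xp.2 m t = false &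
      forall i m, (i <= kC.1)%N -> (m <= kC.1)%N ->
        sum_eval (rep (xp.1 i)) (xp.2 m) = (i == m)].
have [st stP] : {st & forall kC, countable kC.2 -> ok kC (st kC)}.
  apply: (@choice _ _ (fun kC xp => countable kC.2 -> ok kC xp)) => -[k C].
  have [Cc|nCc] := EM (countable C).
    by have [x [phi xphi]] := dual_step k repE Dd Cc; exists (x, phi).
  by exists (fun=> exist _ _ lim_span0, fun _ _ => false) => /nCc.
(* All coordinates of the chosen element are absorbed, so later functions vanish on their
   carriers. *)
pose next k C := C `|` \bigcup_i carrier (rep ((st (k, C)).1 i)).
pose C := fix C k := if k is l.+1 then next l (C l) else set0.
have Cc k : countable (C k).
  elim: k => [|k IHk] /=; first exact: countable0.
  rewrite /next -bigcup2E; apply: bigcup_countable => // -[|[|i]] _ //=.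
  by apply: bigcup_countable => // i _; exact: countable_carrier.
exists (fun k => (st (k, C k)).1), C, (fun k => (st (k, C k)).2).
split=> [k|k|k i t kt|k|k]; try by have [] := stP (k, C k) (Cc k).
  by move=> t Ct; left.
by right; exists i.
Qed.

(** * Failure in the infinite power *)

Hypothesis U_selective : forall a, selective_ultrafilter (U a).
Hypothesis U_incomparable : forall a b, a <> b -> RK_incomparable (U a) (U b).

Lemma not_countably_pracompact_omegapower : ~ countably_pracompact (omegapower G).
Proof.
move=> [D [Dd Dacc]].
have [rep repP] := lim_span_repr; have repE g := (repP g).2.
have [x [C [phi [xD C_mono x_carrier phi_out phi_dual]]]] := dual_sequence repE Dd.
have x_inj : injective x.
  (* For [k < l], [phi l 0] is 1 at coordinate 0 of [x l] but vanishes on [C l], which carries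
     coordinate 0 of [x k]. *)
  suff lt k l : (k < l)%N -> x k <> x l.
    by move=> k l xkl; case: (ltngtP k l) => // /lt []; rewrite xkl.
  move=> kl xkl; have := phi_dual l 0%N 0%N isT isT.
  rewrite -xkl (_ : sum_eval _ _ = false) //.
  rewrite -(sum_eval0 (rep (x k 0%N))); apply: sum_eval_eq => t /x_carrier Ct.
  by apply: phi_out; exact: (C_le C_mono kl).
have x_infinite : infinite_set (range x).
  move=> fin; apply: infinite_nat.
  by apply: sub_finite_set (finite_preimage (in2W x_inj) fin) => k _; exists k.
have x_sub : range x `<=` D by move=> _ [k _ <-].
have [e e_acc] := Dacc _ x_sub x_infinite.
(* The clause [x k <> e] makes [q] free: a singleton of [k] in [q] would force [x k = e]. *)
pose near V := [set k | V (x k) /\ x k <> e].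
have near_filter : ProperFilter (filter_from (nbhs e) near).
  apply: filter_from_proper => [|V /e_acc[t [/eqP te [k _ xkt] Vt]]]; last first.
    by exists k; rewrite /near /= xkt.
  apply: filter_from_filter; first by exists setT; exact: filterT.
  move=> V W Ve We; exists (V `&` W); first exact: filterI.
  by move=> k [[Vk Wk] ke].
have [q [qU near_q]] := ultraFilterLemma near_filter.
have q_ultra : ultrafilter_on_nat q.
  split; first exact: filter_not_empty.
  - exact: filterT.
  - by move=> A B qA AB; exact: filterS qA.
  - by move=> A B; exact: filterI.
  - by move=> A; exact: in_ultra_setVsetC.
have q_near V : nbhs e V -> q (near V) by move=> eV; apply: near_q; exists V.
have q_free A : finite_set A -> ~ q A.
  move=> /finite_seqP[s ->] /(@ultra_seq q id _ q_ultra)[k qk].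
  have xk V : nbhs e V -> V (x k) /\ x k <> e.
    move=> /q_near qV; have [_ _ _ qI _] := q_ultra.
    by have [l [[Vl le] /= lk]] := filter_ex (qI _ _ qV qk); rewrite -lk.
  have [_] := xk _ filterT; apply; apply/funext => i; apply: subcube_inj => j.
  by have [] := xk _ (nbhs_power e i j).
have ev i : all lim_valid (rep (e i)) by case: (repP (e i)).
apply: (no_common_limit C_mono _ phi_out phi_dual q_ultra q_free U_selective
  U_incomparable ev) => [k i|i psi]; first exact: x_carrier.
(* [no_common_limit] asks for every [psi], not only characters; on the countably many points
   involved [psi] agrees with a character. *)
have Cc : countable (\bigcup_k carrier (rep (x k i)) `|` carrier (rep (e i))).
  rewrite -bigcup2E; apply: bigcup_countable => // -[|[|l]] _ //=.
    by apply: bigcup_countable => // k _; exact: countable_carrier.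
  exact: countable_carrier.
have [ix [_ ixE]] := chi_extend psi code_surj Cc.
apply: filterS (q_near _ (nbhs_power e i (ix 0%N))) => k [/= + _].
rewrite !repE (sum_eval_eq (psi := psi)) => [->|t kt]; last by apply: ixE; left; exists k.
by apply: sum_eval_eq => t et; apply: ixE; right.
Qed.

End ultrafilter_sums.

(* The continuum c is the cardinality of set nat (= 2^omega). *)
Theorem mainTheorem11 :
  (exists U : set nat -> set (set nat),
      (forall i, selective_ultrafilter (U i)) /\
      (forall i j, i <> j -> RK_incomparable (U i) (U j))) ->
  exists (G : topologicalType) (mul : G -> G -> G) (inv : G -> G) (e : G),
    [/\ topological_group mul inv e,
        hausdorff_space G,
        (forall n : nat, (0 < n)%N -> countably_pracompact (finpower G n)) &
        ~ countably_pracompact (omegapower G)].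
Proof.
move=> [U [U_sel U_inc]].
have U_ultra a : ultrafilter_on_nat (U a) by case: (U_sel a) => -[].
have U_free a A : finite_set A -> ~ U a A by case: (U_sel a) => -[_ +] _; apply.
have [code code_surj] : coded ((nat -> base) * cantor * nat).
  apply: coded_pair (coded_countable 0%N); apply: coded_pair coded_cantor.
  exact: coded_sequence coded_base.
have [d d_surj] : coded (nat * (nat -> nat -> base)).
  apply: coded_pair (coded_countable 0%N) _.
  exact: coded_sequence (coded_sequence coded_base).
pose dec (a : set nat) := d (fun n => `[< a n >]).
have dec_surj t : exists a, dec a = t.
  have [a <-] := d_surj t; exists [set n | a n].
  by congr d; apply/funext => n; apply/asboolP/idP.
pose S := lim_span U dec code.
exists (subcube S), (subcube_add (lim_spanD (code := code))), id, (subcube_zero (lim_span0 U dec code)).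
split.
- exact: subcube_topological_group.
- exact: hausdorff_subcube.
- by move=> n n_gt0; exact: countably_pracompact_finpower.
- exact: not_countably_pracompact_omegapower.
Qed.
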